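(* Let $d\ge1$. There are a decreasing sequence $(l_n)_{n\ge1}$ of positive reals with $\alpha(l_n)=d$ and a closed set $F\subset\mathbb{T}^d$ with $\dim_P(F)=d$ such that, if $(\xi_n)_{n\ge1}$ are independent random variables uniformly distributed on $\mathbb{T}^d$ and $E=\limsup_{n\to\infty}B(\xi_n,l_n/2)$ is the associated random covering set, then $E\cap F=\emptyset$ almost surely.
   Context: $\mathbb{T}^d$ is the $d$-dimensional torus with its usual (quotient Euclidean) metric and Lebesgue probability measure. $B(x,r)$ is the closed ball of centre $x$ and radius $r$ in $\mathbb{T}^d$. ''Decreasing'' means non-increasing. The random covering set is $E=\limsup_{n\to\infty}B(\xi_n,l_n/2)=\bigcap_{n=1}^\infty\bigcup_{k=n}^\infty B(\xi_k,l_k/2)$. The exponent is $\alpha(l_n)=\sup\{0\le s\le d:\sum_{n=1}^\infty l_n^s=\infty\}$. $\dim_P$ denotes packing dimension. *)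

(* Defs.v *)
From HB Require Import structures.
From mathcomp Require Import all_boot all_order all_algebra archimedean finmap.
From mathcomp Require Import generic_quotient.
From mathcomp Require Import all_classical all_reals all_analysis.
From mathcomp Require Import ring lra.

Set Implicit Arguments.
Unset Strict Implicit.
Unset Printing Implicit Defensive.

Import Order.TTheory GRing.Theory Num.Theory.
Import numFieldNormedType.Exports.

Local Open Scope classical_set_scope.
Local Open Scope ring_scope.
Local Open Scope quotient_scope.

Section EuclideanDistance.
Context {R : realType} {d : nat}.
Implicit Types x y z : d.-tuple R.

(* The norm of the library on ['rV[R]_d] is the sup norm. *)
Definition edist x y : R := Num.sqrt (\sum_i (tnth x i - tnth y i) ^+ 2).

Lemma edistxx x : edist x x = 0.
Proof.
rewrite /edist big1 ?sqrtr0// => i _.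
by rewrite subrr expr0n.
Qed.

Lemma edist_ge0 x y : 0 <= edist x y.
Proof. exact: sqrtr_ge0. Qed.

Lemma edistC x y : edist x y = edist y x.
Proof.
rewrite /edist; congr Num.sqrt; apply: eq_bigr => i _.
by rewrite -sqrrN opprB.
Qed.

Lemma cauchy_schwarz (a b : 'I_d -> R) :
  (\sum_i a i * b i) ^+ 2 <= (\sum_i a i ^+ 2) * (\sum_i b i ^+ 2).
Proof.
set A := \sum_i a i ^+ 2; set B := \sum_i b i ^+ 2.
set C := \sum_i a i * b i.
have B0 : 0 <= B by apply: sumr_ge0 => i _; exact: sqr_ge0.
have [BE|Bn0] := eqVneq B 0.
  have b0 i : b i = 0.
    apply/eqP; rewrite -sqrf_eq0; apply/eqP.
    by apply: (psumr_eq0P _ BE) => // j _; exact: sqr_ge0.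
  rewrite BE mulr0 /C big1 ?expr0n// => i _.
  by rewrite b0 mulr0.
have Bgt0 : 0 < B by rewrite lt0r Bn0.
have : 0 <= \sum_i (B * a i - C * b i) ^+ 2.
  by apply: sumr_ge0 => i _; exact: sqr_ge0.
have -> : \sum_i (B * a i - C * b i) ^+ 2 = B * (A * B - C ^+ 2).
  under eq_bigr => i _.
    have -> : (B * a i - C * b i) ^+ 2 = B ^+ 2 * a i ^+ 2 +
      ((- 2 * B * C) * (a i * b i) + C ^+ 2 * b i ^+ 2) by ring.
    over.
  rewrite !big_split/= -!mulr_sumr -/A -/B -/C; ring.
by rewrite pmulr_rge0// subr_ge0.
Qed.

Lemma edist_triangle y x z : edist x z <= edist x y + edist y z.
Proof.
rewrite -(@ler_pXn2r _ 2)// ?nnegrE ?addr_ge0 ?edist_ge0//.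
rewrite /edist sqrrD !sqr_sqrtr; try by apply: sumr_ge0 => i _; exact: sqr_ge0.
pose a i := tnth x i - tnth y i; pose b i := tnth y i - tnth z i.
have -> : \sum_i (tnth x i - tnth z i) ^+ 2 =
    \sum_i a i ^+ 2 + (\sum_i a i * b i) *+ 2 + \sum_i b i ^+ 2.
  rewrite -sumrMnl -!big_split/=; apply: eq_bigr => i _.
  by rewrite /a /b -mulr_natl; ring.
rewrite lerD2r lerD2l lerMn2r/=.
rewrite (le_trans (ler_norm _))// -sqrtr_sqr -sqrtrM; last first.
  by apply: sumr_ge0 => i _; exact: sqr_ge0.
by rewrite ler_wsqrtr// cauchy_schwarz.
Qed.

Lemma edist_le_sum x y : edist x y <= \sum_i `|tnth x i - tnth y i|.
Proof.
have sge0 : 0 <= \sum_i `|tnth x i - tnth y i| by apply: sumr_ge0.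
rewrite -[leRHS]ger0_norm// -sqrtr_sqr ler_wsqrtr//.
suff : \sum_i (tnth x i - tnth y i) ^+ 2 <=
       (\sum_i `|tnth x i - tnth y i|) ^+ 2 /\
       0 <= \sum_i `|tnth x i - tnth y i| by case.
elim/big_ind2 : _ => [|a b c e [ab b0] [ce e0]|i _].
- by rewrite expr0n.
- by split; [nra|exact: addr_ge0].
- by rewrite -normrX ger0_norm ?sqr_ge0.
Qed.

Lemma coord_le_edist x y i : `|tnth x i - tnth y i| <= edist x y.
Proof.
rewrite -sqrtr_sqr ler_wsqrtr// (bigD1 i)//= lerDl.
by apply: sumr_ge0 => j _; exact: sqr_ge0.
Qed.

End EuclideanDistance.

Definition lattice_equiv {R : realType} {d : nat} (x y : d.-tuple R) : bool :=
  [forall i, tnth x i - tnth y i \is a Num.int].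

Lemma lattice_equiv_is_equiv (R : realType) (d : nat) :
  equiv_class_of (@lattice_equiv R d).
Proof.
split.
- by move=> x; apply/forallP => i; rewrite subrr rpred0.
- move=> x y; apply/forallP/forallP => h i;
    by rewrite -opprB rpredN.
- move=> y x z /forallP xy /forallP yz; apply/forallP => i.
  by rewrite -(subrKA (tnth y i)) rpredD.
Qed.

Canonical lattice_equiv_rel (R : realType) (d : nat) :=
  EquivRelPack (lattice_equiv_is_equiv R d).

Definition torus (R : realType) (d : nat) : Type :=
  {eq_quot (@lattice_equiv R d)}.

HB.instance Definition _ (R : realType) (d : nat) :=
  EqQuotient.on (torus R d).
HB.instance Definition _ (R : realType) (d : nat) := Choice.on (torus R d).

Definition torus_pi {R : realType} {d : nat} (x : d.-tuple R) : torus R d :=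
  \pi_(torus R d) x.

HB.instance Definition _ (R : realType) (d : nat) :=
  isPointed.Build (torus R d) (torus_pi [tuple 0 | i < d]).

Definition torus_dist {R : realType} {d : nat} (p q : torus R d) : R :=
  inf [set edist x y | x in torus_pi @^-1` [set p]
                     & y in torus_pi @^-1` [set q]].

Section TorusMetric.
Context {R : realType} {d : nat}.
Implicit Types (x y z : d.-tuple R) (p q : torus R d).

Lemma torus_piP x y : torus_pi x = torus_pi y <->
  forall i, tnth x i - tnth y i \is a Num.int.
Proof.
by split=> [/eqmodP/forallP//|h]; apply/eqmodP/forallP.
Qed.

Lemma torus_pi_repr p : torus_pi (repr p) = p.
Proof. exact: reprK. Qed.

Let dset p q := [set edist x y | x in torus_pi @^-1` [set p]
                               & y in torus_pi @^-1` [set q]].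

Let dset_lb p q : has_lbound (dset p q).
Proof. by exists 0 => _ [x _ [y _ <-]]; exact: edist_ge0. Qed.

Let dset_inf p q : has_inf (dset p q).
Proof.
split=> //; exists (edist (repr p) (repr q)), (repr p).
  exact: torus_pi_repr.
by exists (repr q) => //; exact: torus_pi_repr.
Qed.

Lemma torus_dist_le x y : torus_dist (torus_pi x) (torus_pi y) <= edist x y.
Proof. by apply: ge_inf; [exact: dset_lb|exists x => //; exists y]. Qed.

Lemma torus_dist_ge0 p q : 0 <= torus_dist p q.
Proof.
apply: lb_le_inf; first by case: (dset_inf p q).
by move=> _ [x _ [y _ <-]]; exact: edist_ge0.
Qed.

Lemma torus_dist_approx p q e : 0 < e -> exists x y,
  [/\ torus_pi x = p, torus_pi y = q & edist x y < torus_dist p q + e].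
Proof.
move=> e0; have [_ [x xp [y yq <-]] lt] := inf_adherent e0 (dset_inf p q).
by exists x, y.
Qed.

Let torus_distxx p : torus_dist p p = 0.
Proof.
apply/eqP; rewrite eq_le torus_dist_ge0 andbT -(torus_pi_repr p).
by rewrite (le_trans (torus_dist_le _ _))// edistxx.
Qed.

Let torus_distC p q : torus_dist p q = torus_dist q p.
Proof.
congr inf; apply/seteqP; split => _ [x xp [y yq <-]];
  by exists y => //; exists x => //; rewrite edistC.
Qed.

Let torus_dist_triangle q p r :
  torus_dist p r <= torus_dist p q + torus_dist q r.
Proof.
apply/ler_addgt0Pl => e e0.
have e20 : 0 < e / 2 by rewrite divr_gt0.
have [x [y [xp yq lt1]]] := torus_dist_approx p q e20.
have [y' [z [yq' zr lt2]]] := torus_dist_approx q r e20.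
pose z' := [tuple tnth z i + (tnth y i - tnth y' i) | i < d].
have yy' : torus_pi y = torus_pi y' by rewrite yq yq'.
have z'r : torus_pi z' = r.
  rewrite -zr; apply/torus_piP => i; rewrite tnth_mktuple addrC addKr.
  by move/torus_piP : yy'; exact.
have yz' : edist y z' = edist y' z.
  rewrite /edist; congr Num.sqrt; apply: eq_bigr => i _.
  by rewrite tnth_mktuple; congr (_ ^+ 2); ring.
rewrite -xp -z'r (le_trans (torus_dist_le _ _))//.
rewrite (le_trans (edist_triangle y _ _))// xp z'r yz'.
lra.
Qed.

Let torus_dist_positivity p q : torus_dist p q = 0 -> p = q.
Proof.
move=> pq0; rewrite -(torus_pi_repr p) -(torus_pi_repr q).
apply/torus_piP => i; set t := tnth _ i - tnth _ i.
apply: contrapT => tZ.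
have t0 : (Num.floor t)%:~R < t.
  rewrite lt_neqAle floor_le_tmp andbT; apply: contra_not_neq tZ => <-.
  exact: intr_int.
have t1 : t < (Num.floor t)%:~R + 1 by rewrite -intrD1 floorD1_gt.
pose e := Num.min (t - (Num.floor t)%:~R) ((Num.floor t)%:~R + 1 - t).
have e0 : 0 < e by rewrite lt_min; apply/andP; split; lra.
have [x [y [xp yq]]] := torus_dist_approx p q e0.
rewrite pq0 add0r => /(le_lt_trans (coord_le_edist x y i)) xye.
have : t - (tnth x i - tnth y i) \is a Num.int.
  have /torus_piP/(_ i) xZ : torus_pi (repr p) = torus_pi x.
    by rewrite torus_pi_repr.
  have /torus_piP/(_ i) yZ : torus_pi (repr q) = torus_pi y.
    by rewrite torus_pi_repr.
  have -> : t - (tnth x i - tnth y i) =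
    (tnth (repr p) i - tnth x i) - (tnth (repr q) i - tnth y i).
    by rewrite /t; ring.
  by rewrite rpredB.
move=> /intrP[k tk].
have {tk} tk : tnth x i - tnth y i = t - k%:~R by rewrite -tk; ring.
move: xye; rewrite tk lt_min => /andP[].
have [kt|kt] := leP k (Num.floor t).
  have : (k%:~R : R) <= (Num.floor t)%:~R by rewrite ler_int.
  by move=> kt' h _; move: h; rewrite ger0_norm; lra.
have : (Num.floor t)%:~R + 1 <= (k%:~R : R).
  by rewrite -intrD1 ler_int lezD1.
by move=> kt' _; rewrite ler0_norm; lra.
Qed.

HB.instance Definition _ := isMetric.Build R (torus R d)
  torus_distxx torus_dist_positivity torus_distC torus_dist_triangle.

End TorusMetric.

HB.instance Definition _ (R : realType) (d : nat) :=
  @isMeasurable.Build (sigma_display (@open (torus R d))) (torus R d)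
    <<s @open (torus R d) >> (@sigma_algebra0 _ setT _) (@sigma_algebraC _ _)
    (@sigma_algebra_bigcup _ setT _).

Section TorusPiMeasurable.
Context {R : realType} {d : nat}.

Let box (c : {ffun 'I_d -> rat}) (r : rat) :
    set (d.-tuple (measurableTypeR R)) :=
  [set y | forall i, `|tnth y i - ratr (c i)| < ratr r].

Let measurable_box c r : measurable (box c r).
Proof.
have -> : box c r = \bigcap_(i in [set: 'I_d])
    ((@tnth d (measurableTypeR R) ^~ i) @^-1` `]ratr (c i) - ratr r, ratr (c i) + ratr r[).
  apply/seteqP; split => y /= yb i; move: (yb i) => /=; rewrite in_itv/=.
    by rewrite ltr_distl.
  by rewrite ltr_distl; apply.
apply: fin_bigcap_measurable => // i _; rewrite -[X in measurable X]setTI.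
by apply: measurable_tnth => //; exact: measurable_itv.
Qed.

Lemma torus_pi_open (U : set (torus R d)) (x : d.-tuple R) :
  open U -> U (torus_pi x) ->
  exists2 e, 0 < e & forall y, edist x y < e -> U (torus_pi y).
Proof.
rewrite openE => /[apply]; rewrite /interior -filter_from_ballE => -[e /= e0 eU].
exists e => // y xye; apply: eU; rewrite ballEmdist/=.
exact: le_lt_trans (torus_dist_le _ _) xye.
Qed.

(* [torus_pi] on R^d equipped with the product of the Borel sigma-algebras that
   [lebesgue_measure] is defined on. *)
Definition torus_proj (x : d.-tuple (measurableTypeR R)) : torus R d :=
  torus_pi x.

Lemma measurable_torus_proj : measurable_fun setT torus_proj.
Proof.
apply: (measurability (@open (torus R d))) => // _ [U oU <-].
rewrite setTI.
pose I := [set cr : {ffun 'I_d -> rat} * rat |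
            box cr.1 cr.2 `<=` torus_pi @^-1` U].
have -> : torus_pi @^-1` U = \bigcup_(cr in I) box cr.1 cr.2.
  apply/seteqP; split => [x /= Ux|x [cr + crx]]; last exact.
  have [e e0 eU] := torus_pi_open oU Ux.
  have e'0 : 0 < e / (2 * d.+1%:R) by rewrite divr_gt0// mulr_gt0.
  have [r /[!in_itv]/= /andP[r0 re]] := rat_in_itvoo e'0.
  have hc i : exists q : rat, `|tnth x i - ratr q| < ratr r.
    have : tnth x i - ratr r < tnth x i + ratr r by lra.
    move=> /rat_in_itvoo[q /[!in_itv]/= /andP[q1 q2]].
    by exists q; rewrite ltr_distl; apply/andP; split; lra.
  pose c : {ffun 'I_d -> rat} := [ffun i => sval (cid (hc i))].
  have cx i : `|tnth x i - ratr (c i)| < ratr r.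
    by rewrite ffunE; case: cid.
  exists (c, r) => //= y /= yb; apply: eU.
  apply: (le_lt_trans (edist_le_sum _ _)).
  apply: (@le_lt_trans _ _ (\sum_(i < d) (2 * ratr r))).
    apply: ler_sum => i _.
    rewrite (le_trans (ler_distD (ratr (c i)) _ _))// mulr_natl mulr2n lerD//.
      exact/ltW/cx.
    by rewrite distrC; exact/ltW/yb.
  rewrite sumr_const card_ord -mulr_natr.
  have lt1 : ratr r * (2 * d.+1%:R) < e by rewrite -ltr_pdivlMr// mulr_gt0.
  have : d%:R <= d.+1%:R :> R by rewrite ler_nat.
  by move=> dd; apply: le_lt_trans lt1; nra.
rewrite bigcup_mkcond; apply: countable_bigcupT_measurable => // cr.
by case: ifP.
Qed.

HB.instance Definition _ :=
  isMeasurableFun.Build _ _ _ _ torus_proj measurable_torus_proj.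

End TorusPiMeasurable.

Section UnitCube.
Context (R : realType).
Local Notation borelR := (measurableTypeR R).

Definition tuple_cons {n : nat} (p : borelR * n.-tuple borelR) :
  n.+1.-tuple borelR := [tuple of p.1 :: p.2].

Lemma measurable_tuple_cons n :
  measurable_fun [set: borelR * n.-tuple borelR] (@tuple_cons n).
Proof. by apply: measurable_cons. Qed.

HB.instance Definition _ n := isMeasurableFun.Build _ _ _ _ (@tuple_cons n)
  (@measurable_tuple_cons n).

Fixpoint unit_cube_prob (n : nat) : probability (n.-tuple borelR) R :=
  match n with
  | 0 => \d_ ([tuple] : 0.-tuple borelR)
  | m.+1 => distribution (uniform_prob (@ltr01 R) \x unit_cube_prob m)%E
      (@tuple_cons m)
  end.

End UnitCube.

(* Opposite faces of the closed unit cube are identified by [torus_pi], and the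
   boundary of the cube is negligible. *)
Definition torus_lebesgue (R : realType) (d : nat) :
    probability (torus R d) R :=
  distribution (unit_cube_prob R d)
    (@torus_proj R d).

Section PackingDimension.
Context {R : realType} {M : metricType R}.
Implicit Types (s delta : R) (F : set M).

Definition cball (x : M) (r : R) : set M := [set y | mdist x y <= r].

(* A countable family of disjoint closed balls centred in F with radii at most
   delta; the index set [I] allows finite families. *)
Definition is_packing delta F (I : set nat) (x : nat -> M) (r : nat -> R) :=
  (forall i, I i -> F (x i) /\ 0 < r i <= delta) /\
  trivIset I (fun i => cball (x i) (r i)).

(* The diameter of the ball of radius r is taken to be 2 r. *)
Definition packing_content s delta F : \bar R :=
  ereal_sup [set v | exists (I : set nat) (x : nat -> M) (r : nat -> R),
    is_packing delta F I x r /\ v = (\esum_(i in I) ((2 * r i) `^ s)%:E)%E].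

(* The content is nondecreasing in [delta], so the infimum is the limit as
   [delta] tends to 0. *)
Definition packing_premeasure s F : \bar R :=
  ereal_inf [set packing_content s delta F | delta in [set delta | 0 < delta]].

Definition packing_measure s F : \bar R :=
  ereal_inf [set (\sum_(0 <= n <oo) packing_premeasure s (G n))%E |
    G in [set G : (set M)^nat | F `<=` \bigcup_n G n]].

Definition packing_dim F : \bar R :=
  ereal_inf [set s%:E | s in [set s | 0 <= s /\ packing_measure s F = 0%E]].

End PackingDimension.

Definition mutually_independent {R : realType} {dO dT : measure_display}
    {Omega : measurableType dO} {T : measurableType dT}
    (P : probability Omega R) (X : nat -> {RV P >-> T}) : Prop :=
  forall (J : {fset nat}) (A : nat -> set T), (forall j, measurable (A j)) ->
    P (\bigcap_(j in [set` J]) X j @^-1` A j) =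
    (\prod_(j <- J) P (X j @^-1` A j))%E.

Definition uniform_on_torus {R : realType} {d : nat} {dO : measure_display}
    {Omega : measurableType dO} (P : probability Omega R)
    (X : {RV P >-> torus R d}) : Prop :=
  forall A : set (torus R d), measurable A ->
    distribution P X A = torus_lebesgue R d A.

(* Sequences are indexed from 0: [l n] stands for the n+1-st length. *)
Definition covering_exponent {R : realType} (d : nat) (l : R^nat) : R :=
  sup [set s | 0 <= s <= d%:R /\ (\sum_(0 <= n <oo) (l n `^ s)%:E = +oo)%E].

Definition covering_set {R : realType} {d : nat} (l : R^nat)
    (x : nat -> torus R d) : set (torus R d) :=
  lim_sup_set (fun n => cball (x n) (l n / 2)).

(* Main.v *)
Require Import Defs.
From mathcomp Require Import all_boot all_order all_algebra archimedean.
From mathcomp Require Import all_classical all_reals all_analysis.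
From mathcomp Require Import measurable_realfun.
From mathcomp Require Import ring lra zify.

Set Implicit Arguments.
Unset Strict Implicit.
Unset Printing Implicit Defensive.

Import Order.TTheory GRing.Theory Num.Theory.
Import numFieldNormedType.Exports.

Local Open Scope classical_set_scope.
Local Open Scope ring_scope.

(** The set is a set of Liouville type.  For frequencies [q_k] and half-widths
    [w_k] with [q_k << 1 / w_k << q_(k+1)], let [F] consist of the points of the
    torus all of whose coordinates are, for every [k], within [w_k] of a
    multiple of [1 / q_k].  It looks small at the scales [w_k] and large at the
    scales [1 / q_k], and the proof plays these two faces against each other.

    At scale [w_k], the set [F] is covered by [q_k ^ d] cubes of side [2 * w_k],
    so its neighbourhood of radius [w_k] has measure of order
    [(q_k * w_k) ^ d] ([torus_lebesgue_hitting]).  One can therefore afford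
    about [2 ^ - k * (q_k * w_k) ^ - d] balls of radius at most [w_k] and still
    have summable probabilities for the event that one of them meets [F]; by
    the Borel-Cantelli lemma almost surely only finitely many balls do
    ([covering_set_liouville_ae]).  As [w_k] is smaller than every fixed power
    of [1 / q_k] when [k] is large, this number of balls exceeds [w_k ^ - s] for
    each [s < d], which makes the exponent of the lengths equal to [d]
    ([covering_exponent_len]).

    At scale [1 / q_(k+1)], a cube of half-width [w_k] with centre in the grid
    of step [1 / q_k] contains about [(w_k * q_(k+1)) ^ d] points of the finer
    grid, and [1 / q_(k+1)] is smaller than every fixed power of [w_k].  Hence
    any set meeting all the small cubes inside a given one carries packings by
    arbitrarily small balls of radius [r] for which the sum of the [(2 * r) ^ s]
    is at least 1, for each [s < d] ([packing_content_dense]).  By a Baire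
    category argument along nested cubes ([liouville_baire]), in any countable
    cover of [F] some member is such a set, so the packing measure of [F] in
    dimension [s] does not vanish.  The packing dimension of any subset of the
    torus is at most [d] because disjoint balls have total measure at most 1
    and a ball of radius [r] has measure at least [(r / d) ^ d]
    ([packing_dim_torus_le]). *)

(** * Distance to the nearest integer *)

Section NearestInteger.
Context {R : realType}.
Implicit Types (t u : R) (z : int).

Definition zdist t : R := `|t - (Num.floor (t + 2^-1))%:~R|.

(** The rounding [floor (t + 1/2)] picks a nearest integer: any other integer is
    at distance at least 1 from it, hence at least 1/2 from [t]. *)
Lemma zdist_le t z : zdist t <= `|t - z%:~R|.
Proof.
rewrite /zdist; set f := Num.floor _.
have f1 : f%:~R <= t + 2^-1 by exact: floor_le.
have f2 : t + 2^-1 < f%:~R + 1 by rewrite -intrD1 floorD1_gt.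
have t2 : `|t - f%:~R| <= 2^-1 by rewrite ler_norml; apply/andP; split; lra.
have [->//|zf] := eqVneq z f.
have : 1 <= `|f%:~R - z%:~R : R|.
  by rewrite -intrB -intr_norm ler1z -gtz0_ge1 normr_gt0 subr_eq0 eq_sym.
have := ler_distD t (f%:~R : R) z%:~R; rewrite (distrC _ t); lra.
Qed.

Lemma zdist_ex t : exists z, zdist t = `|t - z%:~R|.
Proof. by exists (Num.floor (t + 2^-1)). Qed.

Lemma zdist_int t : t \is a Num.int -> zdist t = 0.
Proof.
move=> /intrP[z ->]; apply/eqP; rewrite eq_le normr_ge0 andbT.
by rewrite (le_trans (zdist_le _ z))// subrr normr0.
Qed.

Lemma zdist_int0 t : zdist t <= 0 -> t \is a Num.int.
Proof.
have [z ->] := zdist_ex t; rewrite normr_le0 subr_eq0 => /eqP ->.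
exact: intr_int.
Qed.

Lemma zdistD t u : zdist t <= zdist u + `|t - u|.
Proof.
have [z ->] := zdist_ex u; rewrite (le_trans (zdist_le _ z))//.
by rewrite [leRHS]addrC; exact: ler_distD.
Qed.

Lemma zdist_eqZ t u : t - u \is a Num.int -> zdist t = zdist u.
Proof.
suff W t' u' : t' - u' \is a Num.int -> zdist t' <= zdist u'.
  by move=> tu; apply/eqP; rewrite eq_le !W// -opprB rpredN.
move=> /intrP[m mE]; have [z ->] := zdist_ex u'.
rewrite (le_trans (zdist_le _ (z + m)))// intrD -mE.
by rewrite le_eqVlt; apply/orP; left; apply/eqP; congr `|_|; ring.
Qed.

End NearestInteger.

(** * Measures of boxes *)

Section Boxes.
Context {R : realType}.
Local Notation borelR := (measurableTypeR R).
Local Notation unif := (uniform_prob (@ltr01 R)).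

Lemma uniform_prob_le_lebesgue (A : set borelR) : measurable A ->
  (unif A <= lebesgue_measure A)%E.
Proof.
move=> mA; rewrite -(mul1e (lebesgue_measure A)) -integral_cst//=.
apply: ge0_le_integral => //=.
- by move=> x _; rewrite lee_fin uniform_pdf_ge0.
- by apply/measurable_EFinP/measurable_funTS; exact: measurable_uniform_pdf.
- move=> x _; rewrite lee_fin /uniform_pdf subr0 invr1.
  by case: ifP.
Qed.

Lemma uniform_prob_itv (a b : R) : 0 <= a -> a <= b -> b <= 1 ->
  unif `[a, b]%classic = (b - a)%:E.
Proof.
move=> a0 ab b1; rewrite /uniform_prob (eq_integral (fun=> 1%E)).
  rewrite integral_cst//= mul1e lebesgue_measure_itv/= lte_fin.
  by case: ltP => // ba; have -> : b - a = 0 by lra.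
move=> x; rewrite inE/= in_itv/= => /andP[ax xb].
rewrite /uniform_pdf ifT ?subr0 ?invr1//; lra.
Qed.

(** The sides are indexed by [nat] rather than by ordinals so that removing the
    first coordinate is a shift, as the induction on the dimension needs. *)
Definition box n (A : nat -> set borelR) : set (n.-tuple borelR) :=
  [set x | forall i : 'I_n, A i (tnth x i)].

Lemma measurable_box n (A : nat -> set borelR) : (forall i, measurable (A i)) ->
  measurable (box (n := n) A).
Proof.
move=> mA; have -> : box A = \bigcap_(i in [set: 'I_n])
    ((@tnth n borelR ^~ i) @^-1` A i).
  by apply/seteqP; split => x /= xA i; [move=> _|]; exact: xA.
apply: fin_bigcap_measurable => // i _; rewrite -[X in measurable X]setTI.
exact: measurable_tnth.
Qed.

(** The measure on the cube is built by adjoining one uniform coordinate at a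
    time, so boxes are products for that construction too. *)
Lemma unit_cube_box n (A : nat -> set borelR) : (forall i, measurable (A i)) ->
  unit_cube_prob R n (box A) = (\prod_(i < n) unif (A i))%E.
Proof.
elim: n A => [|n IH] A mA.
  rewrite big_ord0 /= diracE mem_set// => -[]//.
rewrite /= /distribution /pushforward.
have -> : @tuple_cons R n @^-1` box A = A 0%N `*` box (fun i => A i.+1).
  apply/seteqP; split => -[y x]/=.
    move=> yx; split=> [|i]; first by have := yx ord0; rewrite tnth0.
    by have := yx (lift ord0 i); rewrite /= tnthS.
  move=> [Ay Ax] i; have [j ->|->] := unliftP ord0 i.
    by rewrite /= tnthS; exact: Ax.
  by rewrite tnth0.
rewrite product_measure1E//; last exact: measurable_box.
by rewrite big_ord_recl; congr (_ * _)%E; exact: IH.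
Qed.

Lemma unit_cube_box_le n (A : set borelR) (e : R) : measurable A ->
  (unif A <= e%:E)%E -> (unit_cube_prob R n (box (fun=> A)) <= (e ^+ n)%:E)%E.
Proof.
move=> mA Ae; rewrite unit_cube_box//; elim: n => [|n IH].
  by rewrite big_ord0 expr0.
rewrite big_ord_recl exprS EFinM lee_pmul//.
by apply: prode_ge0 => i _.
Qed.

Lemma unit_cube_box_itv n (a : nat -> R) (h : R) : 0 <= h ->
  (forall i, 0 <= a i /\ a i + h <= 1) ->
  unit_cube_prob R n (box (fun i => `[a i, a i + h]%classic)) = (h ^+ n)%:E.
Proof.
move=> h0 ah; rewrite unit_cube_box//.
rewrite (eq_bigr (fun=> h%:E)); last first.
  move=> i _; have [a0 a1] := ah i; rewrite uniform_prob_itv//; last by lra.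
  by congr EFin; ring.
by rewrite prodEFin prodr_const card_ord.
Qed.

End Boxes.

(** * Neighbourhoods of grids and balls in the torus *)

Lemma closed_mdist {R : realType} {M : metricType R} (A : set M) :
  (forall p, (forall e : R, 0 < e -> exists2 q, A q & mdist p q <= e) -> A p) ->
  closed A.
Proof.
move=> Acl p clp; apply: Acl => e e0.
have /clp[q [Aq]] : nbhs p (ball p e) by exact: nbhsx_ballx.
by rewrite ballEmdist/= => /ltW; exists q.
Qed.

Lemma closed_cball {R : realType} {M : metricType R} (p : M) (r : R) :
  closed (cball p r).
Proof.
apply: closed_mdist => q qcl; apply/ler_addgt0Pl => e e0.
have [q' q'r qq'] := qcl e e0.
rewrite (le_trans (metric_triangle _ q' _))// [e + r]addrC lerD//.
by rewrite metric_sym.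
Qed.

Section Torus.
Context {R : realType} {d : nat}.
Implicit Types (p : torus R d) (x : d.-tuple R).

Lemma measurable_torus_closed (A : set (torus R d)) : closed A -> measurable A.
Proof.
move=> cA; rewrite -[A]setCK; apply: measurableC.
by apply: sub_sigma_algebra; exact: closed_openC.
Qed.

(** Points whose coordinates are within [th / q] of the grid of step [1 / q].
    As [q] is an integer, the condition does not depend on the representative
    of a point. *)
Definition grid_nbhd (q : nat) (th : R) : set (torus R d) :=
  [set p | forall i, zdist (q%:R * tnth (repr p) i) <= th].

Lemma grid_nbhd_pi q th x :
  grid_nbhd q th (torus_pi x) <-> forall i, zdist (q%:R * tnth x i) <= th.
Proof.
suff H i : zdist (q%:R * tnth (repr (torus_pi x)) i) = zdist (q%:R * tnth x i).
  by split=> h i; [rewrite -H|rewrite H]; exact: h.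
apply: zdist_eqZ; rewrite -mulrBr rpredM// ?rpred_nat//.
have /torus_piP : torus_pi (repr (torus_pi x)) = torus_pi x.
  exact: torus_pi_repr.
exact.
Qed.

Lemma grid_nbhd_near q th e p p' : grid_nbhd q th p -> mdist p p' <= e ->
  grid_nbhd q (th + q%:R * e) p'.
Proof.
move=> sp pe.
have H e' : 0 < e' -> grid_nbhd q (th + q%:R * (e + e')) p'.
  move=> e'0; have [x [y [xp yp xy]]] := torus_dist_approx p p' e'0.
  rewrite -yp; apply/grid_nbhd_pi => i.
  move: sp; rewrite -xp => /grid_nbhd_pi/(_ i) xth.
  rewrite (le_trans (zdistD _ (q%:R * tnth x i)))// lerD//.
  rewrite -mulrBr normrM normr_nat ler_wpM2l// distrC.
  rewrite (le_trans (coord_le_edist x y i))// (le_trans (ltW xy))// lerD2r//.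
move=> i; apply/ler_addgt0Pl => e' e'0.
have e''0 : 0 < e' / q.+1%:R by rewrite divr_gt0.
rewrite (le_trans (H _ e''0 i))// mulrDr addrA [e' + _]addrC lerD2l.
rewrite mulrCA ger_pMr// ler_pdivrMr// mul1r ler_nat//.
Qed.

Lemma closed_grid_nbhd q th : closed (grid_nbhd q th).
Proof.
apply: closed_mdist => p pcl i; apply/ler_addgt0Pl => e e0.
have e'0 : 0 < e / q.+1%:R by rewrite divr_gt0.
have [p' sp' pp'] := pcl _ e'0.
rewrite metric_sym in pp'.
rewrite (le_trans (grid_nbhd_near sp' pp' i))// addrC lerD2r.
by rewrite mulrCA ger_pMr// ler_pdivrMr// mul1r ler_nat.
Qed.

(** On [[0, 1]] the condition selects the [q + 1] intervals of half-width
    [th / q] around the multiples of [1 / q]; [th < 1] excludes the multiples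
    outside the interval. *)
Lemma uniform_grid_nbhd (q : nat) (th : R) : (0 < q)%N -> 0 <= th < 1 ->
  let A := [set t : measurableTypeR R | zdist (q%:R * t) <= th] in
  measurable A /\
  (uniform_prob (@ltr01 R) A <= (q.+1%:R * (2 * th / q%:R))%:E)%E.
Proof.
move=> q0 /andP[th0 th1] A.
have qp : 0 < q%:R :> R by rewrite ltr0n.
pose J (z : R) := `[(z - th) / q%:R, (z + th) / q%:R]%classic.
have JE (z t : R) : J z t <-> `|q%:R * t - z| <= th.
  rewrite /J /= in_itv/= ler_pdivrMr// ler_pdivlMr// ler_norml.
  by split=> /andP[h1 h2]; apply/andP; split; lra.
have mA : measurable A.
  have -> : A = \bigcup_(z in [set: int]) J z%:~R.
    apply/seteqP; split => t; rewrite /A/=.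
      have [z ->] := zdist_ex (q%:R * t) => tz.
      by exists z => //; exact/JE.
    by move=> [z _ /JE]; apply: le_trans; exact: zdist_le.
  by apply: countable_bigcupT_measurable => // z; exact: measurable_itv.
split=> //.
have -> : uniform_prob (@ltr01 R) A = uniform_prob (@ltr01 R) (A `&` `[0, 1]%classic).
  by rewrite /uniform_prob integral_uniform_pdf.
rewrite (@le_trans _ _ (\sum_(j < q.+1) uniform_prob (@ltr01 R) (J j%:R))%E)//.
  apply: (@content_subadditive _ _ _ (uniform_prob (@ltr01 R)) _
    (fun j : nat => J j%:R)) => //.
  - by move=> j _; exact: measurable_itv.
  - by apply: measurableI => //; exact: measurable_itv.
  move=> t [At /=]; rewrite in_itv/= => /andP[t0 t1].
  have [z zE] := zdist_ex (q%:R * t); rewrite /A/= zE in At; move: At => tz.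
  have : (-1)%:~R < z%:~R :> R.
    by move: tz; rewrite ler_norml => /andP[_]; rewrite rmorphN1; nra.
  rewrite ltr_int => zm1.
  have zq : z%:~R < q.+1%:R :> R.
    by move: tz; rewrite ler_norml -natr1 => /andP[+ _]; nra.
  case: z zm1 zq zE tz => // j _; rewrite -pmulrn ltr_nat => jq _ tj.
  rewrite -(bigcup_mkord q.+1 (fun k => J k%:R)).
  by exists j => //=; exact/JE.
have unifJ (j : 'I_q.+1) :
    (uniform_prob (@ltr01 R) (J j%:R) <= (2 * th / q%:R)%:E)%E.
  rewrite (le_trans (uniform_prob_le_lebesgue _))//; first exact: measurable_itv.
  rewrite lebesgue_measure_itv/= lte_fin; case: ifPn => _.
    by rewrite -EFinB lee_fin -mulrBl ler_wpM2r// ?invr_ge0//; lra.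
  by rewrite lee_fin !mulr_ge0// invr_ge0 ltW.
rewrite (le_trans (lee_sum _ (fun j _ => unifJ j)))//.
by rewrite sumEFin sumr_const card_ord [(q.+1%:R * _)%R]mulr_natl.
Qed.

Lemma torus_lebesgue_grid_nbhd (q : nat) (th : R) : (0 < q)%N -> 0 <= th < 1 ->
  (torus_lebesgue R d (grid_nbhd q th) <=
   ((q.+1%:R * (2 * th / q%:R)) ^+ d)%:E)%E.
Proof.
move=> q0 th01; have [mA Ale] := uniform_grid_nbhd q0 th01.
rewrite /torus_lebesgue /= /distribution /pushforward.
have -> : @torus_proj R d @^-1` grid_nbhd q th =
    box (fun=> [set t : measurableTypeR R | zdist (q%:R * t) <= th]).
  by apply/seteqP; split => x; rewrite /preimage /= /torus_proj => /grid_nbhd_pi.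
exact: unit_cube_box_le.
Qed.

(** Moving each coordinate of the centre by at most [r / d] stays in the ball.
    Moving it upwards from the left half of the unit interval and downwards from
    the right half stays in the unit interval as well, so the ball contains the
    projection of a box of side [r / d] inside the unit cube. *)
Lemma torus_lebesgue_cball p (r : R) : (0 < d)%N -> 0 < r <= 2^-1 ->
  (((r / d%:R) ^+ d)%:E <= torus_lebesgue R d (cball p r))%E.
Proof.
move=> d0 /andP[r0 r2].
have dp : 1 <= d%:R :> R by rewrite ler1n.
pose y : d.-tuple R :=
  [tuple tnth (repr p) i - (Num.floor (tnth (repr p) i))%:~R | i < d].
have yp : torus_pi y = p.
  rewrite -[RHS]torus_pi_repr; apply/torus_piP => i; rewrite tnth_mktuple.
  by rewrite addrAC subrr sub0r rpredN intr_int.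
set h := r / d%:R.
have h0 : 0 < h by rewrite divr_gt0// (lt_le_trans ltr01).
have hr : h <= r by rewrite ler_pdivrMr ?ler_peMr ?(ltW r0)// (lt_le_trans ltr01).
pose a i := if nth 0 y i <= 2^-1 then nth 0 y i else nth 0 y i - h.
have y01 i : 0 <= nth 0 y i <= 1.
  have [iy|iy] := ltnP i d; last by rewrite nth_default ?size_tuple// lexx ler01.
  rewrite -[i]/(nat_of_ord (Ordinal iy)) -tnth_nth tnth_mktuple.
  set t := tnth (repr p) _.
  have := floor_le t; have := floorD1_gt t; rewrite intrD1; lra.
rewrite -(unit_cube_box_itv d (a := a) (ltW h0)); last first.
  by move=> i; have := y01 i; rewrite /a; case: ifPn; rewrite -?ltNge; lra.
rewrite /torus_lebesgue /= /distribution /pushforward le_measure ?inE//.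
- by apply: measurable_box => i; exact: measurable_itv.
- rewrite -[X in measurable X]setTI; apply: measurable_torus_proj => //.
  by apply: measurable_torus_closed; exact: closed_cball.
move=> x xa /=; rewrite /cball/= /torus_proj -yp.
rewrite (le_trans (torus_dist_le y x))// (le_trans (edist_le_sum _ _))//.
apply: (@le_trans _ _ (\sum_(i < d) h)).
  apply: ler_sum => i _; have := xa i; rewrite /= in_itv/= /a (tnth_nth 0 y).
  by case: ifPn => _ /andP[? ?]; rewrite ler_norml; apply/andP; split; lra.
rewrite sumr_const card_ord -mulr_natr /h divfK// gt_eqF//.
exact: lt_le_trans ltr01 dp.
Qed.

End Torus.

(** * Packing dimension is at most d in the torus *)

Section PackingGeneral.
Context {R : realType} {M : metricType R} (x0 : M).
Implicit Types (s delta : R) (F : set M).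

(** The empty packing has sum 0.  Its centres are nevertheless a sequence of
    points, whence the base point [x0]. *)
Lemma packing_content_ge0 s delta F : (0 <= packing_content s delta F)%E.
Proof.
apply: ereal_sup_ubound; exists set0, (fun=> x0), (fun=> 0).
by rewrite esum_set0; split=> //; split=> [i []|i j []].
Qed.

Lemma packing_premeasure_ge0 s F : (0 <= packing_premeasure s F)%E.
Proof.
by apply: le_ereal_inf_tmp => _ [delta _ <-]; exact: packing_content_ge0.
Qed.

Lemma packing_measure_eq0 s F :
  packing_premeasure s F = 0%E -> packing_measure s F = 0%E.
Proof.
move=> F0; apply/eqP; rewrite eq_le; apply/andP; split.
  apply: ereal_inf_lbound; exists (fun=> F); first by move=> x Fx; exists 0%N.
  by apply: eseries0 => i _ _; rewrite F0.
apply: le_ereal_inf_tmp => _ [G _ <-]; apply: nneseries_ge0 => n _ _.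
exact: packing_premeasure_ge0.
Qed.

End PackingGeneral.

Section PackingUpperBound.
Context {R : realType} {d : nat}.
Hypothesis d0 : (0 < d)%N.
Implicit Types (s delta : R) (F : set (torus R d)).

(** For [s > d], each [(2 * r) ^ s] is [(2 * r) ^ (s - d)] times a quantity
    comparable to the measure of the ball of radius [r], and these measures sum
    to at most 1 since the balls are disjoint. *)
Lemma packing_content_torus_le s delta F : d%:R < s -> 0 < delta <= 2^-1 ->
  (packing_content s delta F <=
   ((2 * delta) `^ (s - d%:R) * (2 * d%:R) ^+ d)%:E)%E.
Proof.
move=> ds /andP[de0 de2].
have dp : 0 < d%:R :> R by rewrite ltr0n.
set C := (X in (_ <= X%:E)%E).
have C0 : 0 <= C by rewrite mulr_ge0 ?powR_ge0// exprn_ge0// mulr_ge0// ltW.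
apply: ge_ereal_sup => _ [I [x [r [[Ixr trI] ->]]]].
apply: ge_ereal_sup => _ [J [finJ JI] <-].
have term i : J i -> (((2 * r i) `^ s)%:E <=
    C%:E * torus_lebesgue R d (cball (x i) (r i)))%E.
  move=> /JI/Ixr[_ /andP[r0 rde]].
  have r2 : 0 < r i <= 2^-1 by rewrite r0 (le_trans rde).
  apply: (@le_trans _ _ (C%:E * ((r i / d%:R) ^+ d)%:E)%E); last first.
    by rewrite lee_wpmul2l ?lee_fin// torus_lebesgue_cball.
  rewrite -EFinM lee_fin /C -mulrA -exprMn.
  have -> : 2 * d%:R * (r i / d%:R) = 2 * r i by field; rewrite gt_eqF.
  have -> : (2 * r i) `^ s = (2 * r i) `^ (s - d%:R) * (2 * r i) `^ d%:R.
    rewrite -powRD ?subrK//.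
    by apply/implyP => _; rewrite gt_eqF// mulr_gt0.
  rewrite powR_mulrn ?mulr_ge0 ?(ltW r0)// ler_wpM2r//.
    by rewrite exprn_ge0// mulr_ge0// ltW.
  by rewrite ge0_ler_powR ?nnegrE ?mulr_ge0 ?subr_ge0 ?(ltW r0) ?(ltW ds)
    ?(ltW de0)// ler_wpM2l.
have mB i : measurable (cball (x i) (r i)).
  by apply: measurable_torus_closed; exact: closed_cball.
apply: (le_trans (lee_fsum finJ term)).
rewrite -ge0_mule_fsumr// -measure_fin_bigcup//; last exact: sub_trivIset trI.
rewrite -[leRHS]mule1 lee_wpmul2l ?lee_fin// probability_le1//.
exact: fin_bigcup_measurable.
Qed.

Lemma packing_dim_torus_le F : (packing_dim F <= d%:R%:E)%E.
Proof.
have dp : 0 < d%:R :> R by rewrite ltr0n.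
have C0 : 0 < (2 * d%:R) ^+ d :> R by rewrite exprn_gt0// mulr_gt0.
apply/lee_addgt0Pr => e e0; apply: ereal_inf_lbound.
exists (d%:R + e); last by rewrite EFinD.
split; first by rewrite addr_ge0 ?(ltW e0).
apply: (packing_measure_eq0 (point : torus R d)); apply/eqP.
rewrite eq_le (packing_premeasure_ge0 (point : torus R d)) andbT.
apply/lee_addgt0Pr => eta eta0; rewrite add0e.
(* Chosen so that [u ^ e] times the constant of the previous bound is [eta]. *)
pose u := (eta / (2 * d%:R) ^+ d) `^ e^-1.
have u0 : 0 < u by rewrite powR_gt0// divr_gt0.
pose delta := Num.min u 1 / 2.
have de0 : 0 < delta by rewrite divr_gt0// lt_min u0 ltr01.
have de : 2 * delta = Num.min u 1 by rewrite /delta mulrC divfK.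
apply: (@le_trans _ _ (packing_content (d%:R + e) delta F)).
  by apply: ereal_inf_lbound; exists delta.
apply: (le_trans (packing_content_torus_le _ _ _)).
- by rewrite ltrDl.
- by rewrite de0 /delta ler_pdivrMr// mulVf// ge_min lexx orbT.
rewrite lee_fin de addrAC subrr add0r -ler_pdivlMr//.
have -> : eta / (2 * d%:R) ^+ d = u `^ e.
  by rewrite /u -powRrM mulVf ?gt_eqF// powRr1// divr_ge0 ?ltW.
by rewrite ge0_ler_powR ?nnegrE ?le_min ?ler01 ?(ltW u0) ?(ltW e0)// ge_min lexx.
Qed.

End PackingUpperBound.

(** * The scales *)

Section Exponents.
Local Open Scope nat_scope.

(** The frequencies are [2 ^ aexp k] and the half-widths [2 ^ - bexp k].  Being
    consecutive factorials, the numbers [aexp 0], [bexp 0], [aexp 1], [bexp 1],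
    etc. divide one another and their successive ratios tend to infinity. *)
Definition aexp k := (k.*2.+2)`!.
Definition bexp k := (k.*2.+3)`!.

Lemma bexpE k : bexp k = k.*2.+3 * aexp k. Proof. exact: factS. Qed.

Lemma aexpS k : aexp k.+1 = k.*2.+4 * bexp k.
Proof. by rewrite /aexp doubleS factS. Qed.

Lemma aexp_gt k : k.+1 < aexp k.
Proof.
have := fact_geq k.*2.+2; rewrite /aexp; lia.
Qed.

Lemma aexp_bexp k : aexp k + 4 <= bexp k.
Proof. by rewrite bexpE; have := aexp_gt k; nia. Qed.

Lemma bexp_aexp k : bexp k + 1 <= aexp k.+1.
Proof. by rewrite aexpS; have := aexp_bexp k; nia. Qed.

Definition freq k := 2 ^ aexp k.

End Exponents.

(** * The set and its nested cubes *)

Section Cantor.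
Context {R : realType} {d : nat}.

Definition hwidth k : R := 2 ^- bexp k.

Lemma hwidth_gt0 k : 0 < hwidth k. Proof. by rewrite invr_gt0 exprn_gt0. Qed.

Lemma freq_gt0 k : 0 < (freq k)%:R :> R.
Proof. by rewrite ltr0n expn_gt0. Qed.

Lemma hwidthS k : hwidth k.+1 <= hwidth k / 2.
Proof.
rewrite /hwidth -invfM -exprSr lef_pV2 ?posrE ?exprn_gt0// ler_weXn2l ?ler1n//.
by have := bexp_aexp k; have := aexp_bexp k.+1; lia.
Qed.

Lemma hwidth_antitone m k : (m <= k)%N -> hwidth k <= hwidth m.
Proof.
elim: k => [|k IH]; first by rewrite leqn0 => /eqP ->.
rewrite leq_eqVlt => /predU1P[->//|/IH]; apply: le_trans.
by have := hwidthS k; have := hwidth_gt0 k; lra.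
Qed.

Lemma freq_hwidth k : (freq k)%:R * hwidth k <= 2 ^- 4.
Proof.
rewrite /freq /hwidth natrX ler_pdivrMr ?exprn_gt0// mulrC ler_pdivlMr ?exprn_gt0//.
rewrite -exprD ler_weXn2l ?ler1n//; have := aexp_bexp k; lia.
Qed.

Lemma freqS k : freq k.+1 = (2 ^ (aexp k.+1 - aexp k) * freq k)%N.
Proof.
rewrite /freq -expnD subnK//; have := aexp_bexp k; have := bexp_aexp k; lia.
Qed.

Definition liouville_set : set (torus R d) :=
  \bigcap_k grid_nbhd (freq k) ((freq k)%:R * hwidth k).

Lemma closed_liouville_set : closed liouville_set.
Proof. by apply: closed_bigI => k _; exact: closed_grid_nbhd. Qed.

Implicit Types (c x : d.-tuple R).

Definition cube k c : set (d.-tuple R) :=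
  [set x | forall i, `|tnth x i - tnth c i| <= hwidth k].

(** A condition on the centre which ensures that, up to level [k], the whole cube
    of half-width [hwidth k] around [c] satisfies the conditions that define the
    set; for [m = k] it says that [c] is in the grid of step [1 / freq k]. *)
Definition adapted k c := forall m, (m <= k)%N -> forall i,
  zdist ((freq m)%:R * tnth c i) <= (freq m)%:R * (hwidth m - hwidth k).

(** Stated on centres, this is the inclusion of the cube of level [k'] around
    [c'] in the cube of level [k] around [c]. *)
Definition nested k c k' c' :=
  forall i, `|tnth c' i - tnth c i| <= hwidth k - hwidth k'.

Lemma adapted_grid_nbhd k c x m : adapted k c -> cube k c x -> (m <= k)%N ->
  grid_nbhd (freq m) ((freq m)%:R * hwidth m) (torus_pi x).
Proof.
move=> ck xc mk; apply/grid_nbhd_pi => i.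
rewrite (le_trans (zdistD _ ((freq m)%:R * tnth c i)))//.
rewrite -mulrBr normrM normr_nat.
have := ck m mk i; have := xc i; have := freq_gt0 m; nra.
Qed.

Lemma nested_trans k c k' c' k'' c'' :
  nested k c k' c' -> nested k' c' k'' c'' -> nested k c k'' c''.
Proof.
move=> h h' i; have := ler_distD (tnth c' i) (tnth c'' i) (tnth c i).
have := h i; have := h' i; lra.
Qed.

Definition child k c (f : 'I_d -> nat) : d.-tuple R :=
  [tuple tnth c i + (f i)%:R / (freq k.+1)%:R | i < d].

(** A displacement of half the half-width leaves room for the child because
    [hwidth] at least halves at each step, and the child is in the finer grid
    since [freq k] divides [freq k.+1]. *)
Lemma adapted_child k c f : adapted k c ->
  (forall i, (f i)%:R / (freq k.+1)%:R <= hwidth k / 2) ->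
  adapted k.+1 (child k c f) /\ nested k c k.+1 (child k c f).
Proof.
move=> ck fk; have f0 i : 0 <= (f i)%:R / (freq k.+1)%:R :> R.
  by rewrite divr_ge0.
split; last first.
  move=> i; rewrite tnth_mktuple addrC addKr ger0_norm//.
  have := fk i; have := hwidthS k; lra.
move=> m; rewrite leq_eqVlt => /predU1P[->|mk] i; rewrite tnth_mktuple.
  rewrite subrr mulr0 zdist_int// mulrDr mulrC [_ / _ in X in _ + X]mulrC.
  rewrite mulVKf ?gt_eqF ?freq_gt0// rpredD ?rpred_nat// freqS natrM mulrC -mulrA.
  rewrite rpredM ?rpred_nat//; apply: zdist_int0.
  by have := ck k (leqnn k) i; rewrite subrr mulr0.
rewrite (le_trans (zdistD _ ((freq m)%:R * tnth c i)))//.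
rewrite -mulrBr [tnth c i + _]addrC addrK normrM normr_nat (ger0_norm (f0 i)).
have := ck m mk i; have := fk i; have := freq_gt0 m; have := hwidthS k; nra.
Qed.

(** The zero displacement gives a child with the same centre. *)
Lemma adapted_next k c : adapted k c -> adapted k.+1 c.
Proof.
move=> ck; have [] := @adapted_child k c (fun=> 0%N) ck.
  by move=> i; rewrite mul0r divr_ge0// ltW// hwidth_gt0.
suff -> : child k c (fun=> 0%N) = c by [].
by apply: eq_from_tnth => i; rewrite tnth_mktuple mul0r addr0.
Qed.

Lemma adapted_le k k' c : (k <= k')%N -> adapted k c -> adapted k' c.
Proof.
elim: k' => [|k' IH]; first by rewrite leqn0 => /eqP ->.
rewrite leq_eqVlt => /predU1P[->//|/IH] h /h; exact: adapted_next.
Qed.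

Lemma nested_le k k' c : (k <= k')%N -> nested k c k' c.
Proof. by move=> kk' i; rewrite subrr normr0 subr_ge0 hwidth_antitone. Qed.

(** Only subcubes of strictly larger level are tested, so that successive
    subcubes witnessing the failure of this property have levels tending to
    infinity. *)
Definition dense_in (G : set (torus R d)) k c := forall k' c', (k < k')%N ->
  adapted k' c' -> nested k c k' c' -> exists2 x, cube k' c' x & G (torus_pi x).

(** If every [G n] misses some adapted subcube of every adapted cube, then one
    can choose nested adapted cubes, the [n]-th choice avoiding [G n]; their
    common point belongs to the set but to no [G n].  The levels increase
    strictly, so that this point satisfies the condition of every level. *)
Lemma liouville_baire (G : nat -> set (torus R d)) : liouville_set `<=` \bigcup_n G n ->
  exists n k c, adapted k c /\ dense_in (G n) k c.
Proof.
move=> FG; apply: contrapT => nG.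
pose S := (nat * d.-tuple R)%type.
have /choice[f fP] : forall ns : nat * S, exists s' : S,
    adapted ns.2.1 ns.2.2 -> [/\ (ns.2.1 < s'.1)%N, adapted s'.1 s'.2,
      nested ns.2.1 ns.2.2 s'.1 s'.2 &
      forall x, cube s'.1 s'.2 x -> ~ G ns.1 (torus_pi x)].
  move=> [n [k c]] /=; apply: contrapT => ns; apply: nG.
  exists n, k, c; split.
    by apply: contrapT => nck; apply: ns; exists (k, c).
  move=> k' c' kk' ck' ckk'; apply: contrapT => nx; apply: ns.
  by exists (k', c') => _; split=> // x xc Gx; apply: nx; exists x.
pose c0 : d.-tuple R := [tuple 0 | i < d].
pose fix sg n : S := if n is n'.+1 then f (n', sg n') else (0%N, c0).
have ad n : adapted (sg n).1 (sg n).2.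
  elim: n => [|n IH] /=; last by have [] := fP (n, sg n) IH.
  move=> m m0 i; rewrite tnth_mktuple mulr0 zdist_int ?rpred0// mulr_ge0//.
  by rewrite subr_ge0 hwidth_antitone.
have step n := fP (n, sg n) (ad n).
have lev n : (n <= (sg n).1)%N.
  by elim: n => // n IH; have [/(leq_ltn_trans IH)] := step n.
have nest m n : (m <= n)%N -> nested (sg m).1 (sg m).2 (sg n).1 (sg n).2.
  elim: n => [|n IH]; first by rewrite leqn0 => /eqP ->; exact: nested_le.
  rewrite leq_eqVlt => /predU1P[->|/IH h]; first exact: nested_le.
  by apply: nested_trans h _; have [] := step n.
(* Lower ends of the sides of the cubes; their suprema are the coordinates of
   a common point. *)
pose lo i n : R := tnth (sg n).2 i - hwidth (sg n).1.
have lohi i m n : lo i m <= tnth (sg n).2 i + hwidth (sg n).1.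
  have r0 := hwidth_gt0; have rm := r0 (sg m).1; have rn := r0 (sg n).1.
  rewrite /lo; have [mn|/ltnW nm] := leqP m n.
    by have := nest _ _ mn i; rewrite ler_norml => /andP[]; lra.
  by have := nest _ _ nm i; rewrite ler_norml => /andP[]; lra.
pose x : d.-tuple R := [tuple sup (range (lo i)) | i < d].
have xc n : cube (sg n).1 (sg n).2 x.
  move=> i; rewrite tnth_mktuple ler_distl; apply/andP; split.
    apply: ub_le_sup; last by exists n.
    by exists (tnth (sg n).2 i + hwidth (sg n).1) => _ [m _ <-].
  apply: ge_sup; first by exists (lo i 0%N), 0%N.
  by move=> _ [m _ <-].
have [n _ Gx] : (\bigcup_n G n) (torus_pi x).
  apply: FG => k _; exact: adapted_grid_nbhd (ad k) (xc k) (lev k).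
by have [_ _ _ /(_ x (xc n.+1))] := step n.
Qed.

End Cantor.

(** * Packing dimension is at least d for the set *)

Lemma packing_content_ge_finite {R : realType} {M : metricType R}
    (T : finType) (y : T -> M) (x0 : M) (s rho delta : R) (G : set M) :
  (forall f, G (y f)) -> 0 < rho <= delta ->
  (forall f g, f != g -> 2 * rho < mdist (y f) (y g)) ->
  ((#|T|%:R * (2 * rho) `^ s)%:E <= packing_content s delta G)%E.
Proof.
move=> yG rhod sep.
pose x n := if insub n is Some i then y (@enum_val T predT i) else x0.
have xE (i : 'I_#|T|) : x i = y (enum_val i) by rewrite /x valK.
apply: ereal_sup_ubound; exists `I_#|T|, x, (fun=> rho); split.
  split=> [n nT|i j /= iT jT [z [/= zi zj]]].
    by rewrite -[n]/(nat_of_ord (Ordinal nT)) xE.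
  apply: contrapT => /eqP ij.
  have xi := xE (Ordinal iT); have xj := xE (Ordinal jT).
  rewrite /= in xi xj.
  have /sep : enum_val (Ordinal iT) != enum_val (Ordinal jT).
    by rewrite (inj_eq enum_val_inj).
  rewrite -xi -xj; have := metric_triangle (x i) z (x j).
  rewrite (metric_sym z); move: zi zj; rewrite /cball/=; lra.
rewrite esum_fset//; last by move=> i _; rewrite lee_fin powR_ge0.
rewrite -(fsbig_ord _ _ (fun=> ((2 * rho) `^ s)%:E))/= sumEFin sumr_const.
by rewrite card_ord mulr_natl.
Qed.

Section PackingLowerBound.
Context {R : realType} {d : nat}.
Implicit Types (c x : d.-tuple R) (G : set (torus R d)).

(** The number of children of a cube along each coordinate axis. *)
Definition branching k := (2 ^ (aexp k.+1 - bexp k - 1))%N.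

(** One eighth of the step of the grid of level [k.+1]. *)
Definition sep_rad k : R := 2 ^- (aexp k.+1 + 3).

Lemma branchingE k : (branching k)%:R / (freq k.+1)%:R = hwidth k / 2 :> R.
Proof.
have -> : freq k.+1 = (branching k * 2 ^ (bexp k).+1)%N.
  by rewrite /freq /branching -expnD; congr expn; have := bexp_aexp k; lia.
have b0 : (branching k)%:R != 0 :> R by rewrite gt_eqF// ltr0n expn_gt0.
by rewrite natrM invfM mulVKf// natrX /hwidth exprSr invfM.
Qed.

Lemma sep_rad_freq k : sep_rad k * 8 = (freq k.+1)%:R^-1.
Proof.
rewrite /sep_rad /freq natrX exprD invfM -mulrA.
by have -> : 2 ^- 3 * 8 = 1 :> R; [field|rewrite mulr1].
Qed.

Lemma hwidth_freqS k : hwidth k.+1 <= (freq k.+1)%:R^-1 / 16 :> R.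
Proof.
have := freq_hwidth (R := R) k.+1; have q0 := freq_gt0 (R := R) k.+1.
have -> : 2 ^- 4 = 16^-1 :> R by field.
by rewrite mulrC -ler_pdivlMr// [16^-1 / _]mulrC.
Qed.

Lemma hwidth_le k : hwidth k <= 16^-1 :> R.
Proof.
have := freq_hwidth (R := R) k; have := hwidth_gt0 (R := R) k.
have : 1 <= (freq k)%:R :> R by rewrite ler1n expn_gt0.
have -> : 2 ^- 4 = 16^-1 :> R by field.
nra.
Qed.

(** Some coordinate of [x - y] exceeds in absolute value most of the step of the
    grid, as the half-width of the children is a small fraction of it.  Passing
    to the torus does not bring the points closer: both lie in one cube of side
    less than 1/2, so no nonzero integer is near that coordinate. *)
Lemma child_separated k c (f g : 'I_d -> nat) x y :
  (forall i, (f i < branching k)%N) -> (forall i, (g i < branching k)%N) ->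
  cube k.+1 (child k c f) x -> cube k.+1 (child k c g) y ->
  (exists i, f i != g i) ->
  2 * sep_rad k < mdist (torus_pi x) (torus_pi y).
Proof.
move=> fM gM xf yg [i fg]; rewrite ltNge; apply/negP => xy.
have q0 := freq_gt0 (R := R) k.+1; have r0 := hwidth_gt0 (R := R) k.+1.
have rq := hwidth_freqS k; have sq := sep_rad_freq k; have rk := hwidth_le k.
have s0 : 0 < sep_rad k by rewrite invr_gt0 exprn_gt0.
(* Representatives of the two points that almost realize their distance. *)
have [x' [y' [xx' yy' xy']]] :=
  torus_dist_approx (torus_pi x) (torus_pi y) s0.
have {}xy' : `|tnth x' i - tnth y' i| < 3 * sep_rad k.
  rewrite (le_lt_trans (coord_le_edist _ _ _))// (lt_le_trans xy')//.
  have := xy : torus_dist (torus_pi x) (torus_pi y) <= 2 * sep_rad k; lra.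
move/torus_piP/(_ i)/intrP : xx' => [m mE].
move/torus_piP/(_ i)/intrP : yy' => [n nE].
pose t := tnth x i - tnth y i.
have tE : tnth x' i - tnth y' i = t - (n - m)%:~R.
  by rewrite intrB -mE -nE /t; ring.
move: (xf i) (yg i); rewrite !tnth_mktuple => xfi ygi.
set u := (freq k.+1)%:R^-1 in rq sq xfi ygi.
have fb (h : 'I_d -> nat) : (forall i, (h i < branching k)%N) ->
    0 <= (h i)%:R * u <= hwidth k / 2.
  move=> hM; rewrite mulr_ge0 ?invr_ge0 ?(ltW q0)//= -branchingE.
  by rewrite ler_wpM2r ?invr_ge0 ?(ltW q0)// ler_nat ltnW.
have u0 : 0 < u by rewrite invr_gt0.
have fgu : u <= `|(f i)%:R * u - (g i)%:R * u|.
  rewrite -mulrBl normrM (gtr0_norm u0) ler_peMl ?(ltW u0)//.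
  move: fg; rewrite neq_ltn => /orP[fg|fg].
    rewrite distrC; have := fg; rewrite -(ler_nat R) -natr1 => h.
    by rewrite (le_trans _ (ler_norm _))//; lra.
  have := fg; rewrite -(ler_nat R) -natr1 => h.
  by rewrite (le_trans _ (ler_norm _))//; lra.
have /andP[f0 f1] := fb f fM; have /andP[g0 g1] := fb g gM.
have t1 : `|t| <= 2^-1.
  move: xfi ygi; rewrite /t !ler_norml => /andP[? ?] /andP[? ?].
  have rS := hwidthS (R := R) k; have rr := hwidth_gt0 (R := R) k.
  by apply/andP; split; lra.
have [nm|nm] := eqVneq (n - m) 0.
  move: xy'; rewrite tE nm subr0 /t.
  move: xfi ygi fgu; rewrite !ler_norml ltr_norml ler_normr.
  by move=> /andP[? ?] /andP[? ?] /orP[?|?] /andP[? ?]; lra.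
have : 1 <= `|(n - m)%:~R : R|.
  by rewrite -intr_norm ler1z -gtz0_ge1 normr_gt0.
have u1 : u <= 1 by rewrite invf_le1// ler1n expn_gt0.
have := ler_distD t (n - m)%:~R 0; rewrite !subr0 distrC -tE; lra.
Qed.

(** The bounds on the exponents hold because [aexp K.+1] is [2 * K + 4] times
    [bexp K], so the gain [(d - s) * aexp K.+1] absorbs the loss [d * bexp K]. *)
Lemma branching_mass K (s : R) : 0 <= s <= d%:R ->
  4 * d%:R + 1 <= (d%:R - s) * (K.*2.+4)%:R ->
  1 <= ((branching K) ^ d)%:R * (2 * sep_rad K) `^ s.
Proof.
move=> /andP[s0 sd] Kd.
have b0 : 1 <= (bexp K)%:R :> R by rewrite ler1n fact_gt0.
have aE : (aexp K.+1)%:R = (K.*2.+4)%:R * (bexp K)%:R :> R.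
  by rewrite aexpS natrM.
have -> : 2 * sep_rad K = 2 `^ (- ((aexp K.+1)%:R + 2)).
  rewrite powRN -natrD powR_mulrn// /sep_rad (addnS _ 2) exprS invfM.
  by rewrite mulVKf// pnatr_eq0.
have -> : ((branching K) ^ d)%:R =
    2 `^ (((aexp K.+1)%:R - (bexp K)%:R - 1) * d%:R) :> R.
  rewrite /branching -expnM natrX -powR_mulrn// natrM !natrB//.
    by have := bexp_aexp K; lia.
  by have := bexp_aexp K; lia.
rewrite -powRrM -powRD; last by rewrite pnatr_eq0 implybT.
rewrite -[leLHS](powRr0 2) ler_powR ?ler1n// aE.
set N := (K.*2.+4)%:R in Kd *; set b := (bexp K)%:R in b0 *.
set D := d%:R in sd Kd *.
have : b * (4 * D + 1) <= b * ((D - s) * N) by rewrite ler_wpM2l//; lra.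
have : D <= b * D by rewrite ler_peMl//; lra.
lra.
Qed.

(** Choosing one point of [G] in each child of a cube of large level [K] gives
    the centres of a packing.  The descent from level [k] to level [K] keeps the
    centre [c]. *)
Lemma packing_content_dense G k c (s delta : R) :
  adapted k c -> dense_in G k c -> 0 <= s < d%:R -> 0 < delta ->
  (1 <= packing_content s delta G)%E.
Proof.
move=> kc Gkc /andP[s0 sd] de0.
have ds : 0 < d%:R - s by rewrite subr_gt0.
(* The first bound on [K] is for [branching_mass], the second one makes the
   radius at most [delta]. *)
pose K := maxn k (maxn (Num.truncn ((4 * d%:R + 1) / (d%:R - s))).+1
                       (Num.truncn delta^-1).+1).
have kK : (k <= K)%N by rewrite leq_maxl.
have K1 : (4 * d%:R + 1) / (d%:R - s) <= K%:R.
  rewrite (le_trans (ltW (truncnS_gt _)))// ler_nat /K !leq_max leqnn ?orbT//.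
have K2 : delta^-1 <= K%:R.
  rewrite (le_trans (ltW (truncnS_gt _)))// ler_nat /K !leq_max leqnn ?orbT//.
have Kc := adapted_le kK kc.
pose T := {ffun 'I_d -> 'I_(branching K)}.
have ch (f : T) : exists x,
    cube K.+1 (child K c (fun i => f i)) x /\ G (torus_pi x).
  have [] := @adapted_child _ _ K c (fun i => f i) Kc.
    move=> i; rewrite -branchingE ler_wpM2r ?invr_ge0 ?(ltW (freq_gt0 _))//.
    by rewrite ler_nat ltnW.
  move=> adf nf; have [] := Gkc K.+1 (child K c (fun i => f i)) _ adf _.
  - by rewrite ltnS.
  - by apply: nested_trans nf; exact: nested_le.
  by move=> x; exists x.
have [x xP] := choice ch.
have rho0 : 0 < sep_rad K by rewrite invr_gt0 exprn_gt0.
have rhode : sep_rad K <= delta.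
  rewrite -[delta]invrK lef_pV2 ?posrE ?invr_gt0 ?exprn_gt0//.
  rewrite (le_trans K2)// -natrX ler_nat (leq_trans (ltnW (ltn_expl K (ltnSn 1))))//.
  by rewrite leq_exp2l//; have := aexp_gt K.+1; lia.
apply: (@le_trans _ _ ((#|T|%:R * (2 * sep_rad K) `^ s)%:E)).
  rewrite card_ffun !card_ord lee_fin branching_mass//; first by rewrite s0 ltW.
  rewrite [leRHS]mulrC -ler_pdivrMr// (le_trans K1)// ler_nat; lia.
apply: (@packing_content_ge_finite _ _ T (fun f => torus_pi (x f))) => //.
- exact: (torus_pi c).
- by move=> f; have [] := xP f.
- by rewrite rho0.
move=> f g fg; apply: (child_separated (k := K) (c := c) (f := fun i => f i) (g := fun i => g i)) => //.
- by have [] := xP f.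
- by have [] := xP g.
apply/existsP; apply: contra_neqT fg; rewrite negb_exists => /forallP fg.
by apply/ffunP => i; apply/val_inj/eqP; have := fg i; rewrite negbK.
Qed.

Lemma packing_dim_liouville_ge : (d%:R%:E <= packing_dim (@liouville_set R d))%E.
Proof.
apply: le_ereal_inf_tmp => _ [s [s0 Fs0] <-]; rewrite lee_fin leNgt.
apply/negP => sd.
have : (packing_measure s (@liouville_set R d) < 1)%E by rewrite Fs0 lte_fin.
move=> /ereal_inf_lt[_ [G FG <-]].
have [n [k [c [kc Gkc]]]] := liouville_baire FG.
apply/negP; rewrite -leNgt.
have pt : torus R d := point.
have G0 m : (0 <= packing_premeasure s (G m))%E by exact: packing_premeasure_ge0.
apply: (@le_trans _ _ (packing_premeasure s (G n))).
  apply: le_ereal_inf_tmp => _ [delta /= de0 <-].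
  by apply: (packing_content_dense kc) => //; rewrite s0.
apply: (@le_trans _ _ (\sum_(0 <= m < n.+1) packing_premeasure s (G m))%E).
  by rewrite big_nat_recr//= leeDr// sume_ge0.
exact: nneseries_lim_ge.
Qed.

End PackingLowerBound.

(** * The lengths and the Borel-Cantelli argument *)

Section Lengths.
Variable d : nat.
Hypothesis d0 : (0 < d)%N.

(** [2 ^ - k] times the inverse of [(freq k * hwidth k) ^ d]. *)
Definition nballs k := (2 ^ (d * (bexp k - aexp k) - k))%N.

Lemma nballs_exp k : (k.*2 < d * (bexp k - aexp k))%N.
Proof.
have H : (k.*2 < bexp k - aexp k)%N.
  by rewrite bexpE; have := aexp_gt k; nia.
by rewrite (leq_trans H)// leq_pmull.
Qed.

Lemma nballs_gt k : (k < nballs k)%N.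
Proof.
rewrite (leq_trans (ltn_expl k (ltnSn 1)))// leq_exp2l//.
by have := nballs_exp k; lia.
Qed.

Let nballs_ex n : exists k, (n < nballs k)%N.
Proof. by exists n; exact: nballs_gt. Qed.

(** The lengths with indices below [nballs k] are at least [hwidth k]; the
    index of the scale is the least [k] for which this is imposed. *)
Definition scale n := ex_minn (nballs_ex n).

Lemma lt_nballs_scale n : (n < nballs (scale n))%N.
Proof. by rewrite /scale; case: ex_minnP. Qed.

Lemma scale_le n k : (n < nballs k)%N -> (scale n <= k)%N.
Proof. by rewrite /scale; case: ex_minnP => m _; exact. Qed.

Lemma scale_homo m n : (m <= n)%N -> (scale m <= scale n)%N.
Proof. by move=> mn; apply/scale_le/(leq_ltn_trans mn)/lt_nballs_scale. Qed.

Lemma scale_unbounded K : exists n0, forall n, (n0 <= n)%N -> (K <= scale n)%N.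
Proof.
exists (\max_(k < K) nballs k) => n nK; rewrite leqNgt; apply/negP => bK.
have : (nballs (scale n) <= \max_(k < K) nballs k)%N.
  exact: (leq_bigmax (Ordinal bK)).
by move=> /(leq_trans (lt_nballs_scale n))/leq_trans/(_ nK); rewrite ltnn.
Qed.

Context {R : realType}.

Definition len (n : nat) : R := hwidth (scale n).

Lemma len_gt0 n : 0 < len n. Proof. exact: hwidth_gt0. Qed.

Lemma len_nonincreasing : nonincreasing_seq len.
Proof. by move=> m n mn; apply/hwidth_antitone/scale_homo. Qed.

(** [bexp K] is [2 * K + 3] times [aexp K], so [(d - s) * bexp K] absorbs the
    loss [d * aexp K + K] in the exponent of [nballs K], with [K] to spare. *)
Lemma nballs_mass K (s : R) : 0 <= s <= d%:R ->
  d%:R + 2 <= (d%:R - s) * (K.*2.+3)%:R ->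
  K%:R <= (nballs K)%:R * hwidth K `^ s.
Proof.
move=> /andP[s0 sd] Kd.
apply: (@le_trans _ _ (2 `^ K%:R)).
  by rewrite powR_mulrn// -natrX ler_nat ltnW// ltn_expl.
have -> : hwidth K = 2 `^ (- (bexp K)%:R) :> R by rewrite powRN powR_mulrn.
have bE : (bexp K)%:R = (K.*2.+3)%:R * (aexp K)%:R :> R by rewrite bexpE natrM.
have -> : (nballs K)%:R =
    2 `^ (d%:R * ((bexp K)%:R - (aexp K)%:R) - K%:R) :> R.
  have ab : (aexp K <= bexp K)%N by have := aexp_bexp K; lia.
  have Kb : (K <= d * (bexp K - aexp K))%N by have := nballs_exp K; lia.
  by rewrite -natrB// -natrM -natrB// powR_mulrn// /nballs natrX.
rewrite -powRrM -powRD; last by rewrite pnatr_eq0 implybT.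
rewrite ler_powR ?ler1n// bE.
have : K%:R <= (aexp K)%:R :> R by rewrite ler_nat; have := aexp_gt K; lia.
have : 0 <= (aexp K)%:R :> R by [].
set N := (K.*2.+3)%:R in Kd *; set a := (aexp K)%:R; set D := d%:R in sd Kd *.
move=> a0 Ka; have := ler_wpM2l a0 Kd; lra.
Qed.

(** The first [nballs K] terms are at least [hwidth K ^ s], so by the previous
    lemma the partial sums are unbounded. *)
Lemma len_series_diverges (s : R) : 0 <= s < d%:R ->
  (\sum_(0 <= n <oo) (len n `^ s)%:E = +oo)%E.
Proof.
move=> /andP[s0 sd]; apply/eqyP => A A0.
have ds : 0 < d%:R - s by rewrite subr_gt0.
pose K := maxn (Num.truncn ((d%:R + 2) / (d%:R - s))).+1 (Num.truncn A).+1.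
have K1 : (d%:R + 2) / (d%:R - s) <= K%:R.
  by rewrite (le_trans (ltW (truncnS_gt _)))// ler_nat leq_maxl.
have K2 : A <= K%:R.
  by rewrite (le_trans (ltW (truncnS_gt _)))// ler_nat leq_maxr.
apply: le_trans (nneseries_lim_ge (nballs K) _); last first.
  by move=> n _ _; rewrite lee_fin powR_ge0.
rewrite sumEFin lee_fin (le_trans K2)//.
have Kd : d%:R + 2 <= (d%:R - s) * (K.*2.+3)%:R.
  by rewrite [leRHS]mulrC -ler_pdivrMr// (le_trans K1)// ler_nat; lia.
rewrite (le_trans (nballs_mass _ Kd)) ?s0 ?(ltW sd)//.
rewrite big_mkord -[X in X%:R * _]card_ord mulr_natl -sumr_const.
apply: ler_sum => n _; rewrite ge0_ler_powR ?nnegrE ?(ltW (hwidth_gt0 _))//.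
by rewrite hwidth_antitone// scale_le.
Qed.

Lemma covering_exponent_len : covering_exponent d len = d%:R.
Proof.
rewrite /covering_exponent; set A := (X in sup X).
have Ad : ubound A d%:R by move=> s [/andP[]].
have inA s : 0 <= s < d%:R -> A s.
  move=> sd; split; last exact: len_series_diverges.
  by case/andP: sd => -> /ltW ->.
apply/eqP; rewrite eq_le; apply/andP; split.
  by apply: ge_sup => //; exists 0; apply: inA; rewrite lexx ltr0n.
apply/ler_addgt0Pl => e e0; rewrite -lerBlDl.
apply: (@le_trans _ _ (Num.max 0 (d%:R - e))); first by rewrite le_max lexx orbT.
have : A (Num.max 0 (d%:R - e)).
  by apply: inA; rewrite le_max lexx/= gt_max ltr0n d0/= gtrBl.
by apply: ub_le_sup; exists d%:R.
Qed.

Lemma nballs_freq_hwidth k :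
  (nballs k)%:R * ((freq k)%:R * hwidth k) ^+ d = 2 ^- k :> R.
Proof.
have ab : (aexp k <= bexp k)%N by have := aexp_bexp k; lia.
have -> : (freq k)%:R * hwidth k = 2 ^- (bexp k - aexp k) :> R.
  by rewrite /hwidth -{1}(subnKC ab) exprD invfM /freq natrX mulVKf.
rewrite exprVn -exprM mulnC /nballs natrX.
have kn : (k <= d * (bexp k - aexp k))%N by have := nballs_exp k; lia.
by rewrite -{2}(subnK kn) exprD invfM mulVKf.
Qed.

(** The neighbourhood of the level [k] condition in which the centre of a ball
    of radius at most [hwidth k] must lie for the ball to meet the set. *)
Definition hitting k : set (torus R d) :=
  grid_nbhd (freq k) ((freq k)%:R * hwidth k + (freq k)%:R * hwidth k).

(** Up to the factor [8 ^ d] this is [nballs_freq_hwidth]; the bound is written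
    as a term of the series that [cvg_geometric_eseries_half] sums. *)
Lemma torus_lebesgue_hitting k : ((nballs k)%:R%:E * torus_lebesgue R d (hitting k) <=
  (2 * 8 ^+ d / (2 ^ (k + 1))%:R)%:E)%E.
Proof.
have q0 := freq_gt0 (R := R) k; have w0 := hwidth_gt0 (R := R) k.
have fw := freq_hwidth (R := R) k.
have th01 : 0 <= (freq k)%:R * hwidth k + (freq k)%:R * (hwidth k : R) < 1.
  have t0 : 0 <= (freq k)%:R * hwidth k :> R by rewrite mulr_ge0// ltW.
  apply/andP; split; first by rewrite addr_ge0.
  have : 2 ^- 4 = 16^-1 :> R by field.
  by move=> E; move: fw; rewrite E; lra.
have qn : (0 < freq k)%N by rewrite expn_gt0.
have H := torus_lebesgue_grid_nbhd (d := d) qn th01.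
apply: (@le_trans _ _ ((nballs k)%:R%:E * ((8 * ((freq k)%:R * hwidth k)) ^+ d)%:E)%E).
  rewrite lee_wpmul2l ?lee_fin// (le_trans H)// lee_fin lerXn2r ?nnegrE//.
  - by rewrite mulr_ge0// divr_ge0 ?(ltW q0)// mulr_ge0//; case/andP: th01.
  - by rewrite !mulr_ge0// ltW.
  have -> : 2 * ((freq k)%:R * hwidth k + (freq k)%:R * hwidth k) / (freq k)%:R =
    4 * hwidth k :> R by field; rewrite gt_eqF.
  have : (freq k).+1%:R <= 2 * (freq k)%:R :> R.
    by rewrite -natrM ler_nat; lia.
  nra.
rewrite -EFinM lee_fin exprMn mulrCA nballs_freq_hwidth.
rewrite addn1 expnS natrM invfM natrX mulrACA divff// mul1r//.
Qed.

(** A point of the set lying in infinitely many balls produces hits at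
    arbitrarily large scales.  Grouping the balls by scale lets a union bound
    replace the sum over all balls in the Borel-Cantelli lemma. *)
Lemma covering_set_hitting (x : nat -> torus R d) (N : nat) :
  covering_set len x `&` liouville_set !=set0 ->
  exists2 k, (N <= k)%N & exists2 n, (n < nballs k)%N & hitting k (x n).
Proof.
move=> [y [xy Fy]]; have [n0 n0P] := scale_unbounded N.
have [n /= n0n yn] := xy n0 I.
exists (scale n); first exact: n0P.
exists n; first exact: lt_nballs_scale.
apply: (grid_nbhd_near (p := y)); first exact: Fy.
rewrite metric_sym (le_trans yn)// ler_pdivrMr// ler_peMr ?ler1n//.
exact/ltW/hwidth_gt0.
Qed.

Lemma covering_set_liouville_ae (dO : measure_display) (Omega : measurableType dO)
    (P : probability Omega R) (xi : nat -> {RV P >-> torus R d}) :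
  (forall n, uniform_on_torus (xi n)) ->
  {ae P, forall w, covering_set len (fun n => xi n w) `&` liouville_set = set0}.
Proof.
move=> xiU.
have mV k : measurable (hitting k).
  by apply: measurable_torus_closed; exact: closed_grid_nbhd.
have mxi n k : measurable (xi n @^-1` hitting k) by exact: measurable_funPTI.
pose B k := \big[setU/set0]_(n < nballs k) xi n @^-1` hitting k.
have mB k : measurable (B k) by apply: bigsetU_measurable.
have PB k : (P (B k) <= (2 * 8 ^+ d / (2 ^ (k + 1))%:R)%:E)%E.
  apply: le_trans (torus_lebesgue_hitting k).
  have sub : (P (B k) <= \sum_(n < nballs k) P (xi n @^-1` hitting k))%E.
    by apply: (@content_subadditive _ _ _ P _ (fun n => xi n @^-1` hitting k)).
  rewrite (le_trans sub)// (eq_bigr (fun=> torus_lebesgue R d (hitting k))); last first.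
    by move=> n _; exact: xiU.
  by rewrite sumr_const card_ord mule_natl.
exists (lim_sup_set B); split.
- by apply: bigcap_measurable => // n _; exact: bigcup_measurable.
- apply: lim_sup_set_cvg0 => //.
  apply: (@le_lt_trans _ _
      (\sum_(k <oo) (2 * 8 ^+ d / (2 ^ (k + 1))%:R)%:E)%E).
    apply: lee_nneseries => [k _ _|k _]; first exact: measure_ge0.
    exact: PB.
  by rewrite (cvg_lim _ (@cvg_geometric_eseries_half R (2 * 8 ^+ d) 0))// ltry.
move=> w /= nw N _.
have [|k Nk [n nk xn]] := @covering_set_hitting (fun n => xi n w) N.
  by apply/set0P/eqP.
exists k => //; rewrite /B -(bigcup_mkord _ (fun n => xi n @^-1` hitting k)).
by exists n.
Qed.

End Lengths.

Theorem proposition1p3 (R : realType) (d : nat) (hd : (1 <= d)%N) :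
  exists (l : R^nat) (F : set (torus R d)),
    [/\ (forall n, 0 < l n) /\ nonincreasing_seq l,
        covering_exponent d l = d%:R,
        closed F,
        packing_dim F = (d%:R)%:E &
        forall (dO : measure_display) (Omega : measurableType dO)
          (P : probability Omega R) (xi : nat -> {RV P >-> torus R d}),
          mutually_independent xi ->
          (forall n, uniform_on_torus (xi n)) ->
          {ae P, forall w, covering_set l (fun n => xi n w) `&` F = set0}].
Proof.
exists (len hd), liouville_set; split.
- by split; [exact: len_gt0|exact: len_nonincreasing].
- exact: covering_exponent_len.
- exact: closed_liouville_set.
- by apply/eqP; rewrite eq_le packing_dim_torus_le// packing_dim_liouville_ge.
- by move=> dO Omega P xi _ xiU; exact: covering_set_liouville_ae.
Qed.
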